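(* Let $n\ge 4$ be an even integer, $m$ a positive integer, $(\Lambda,b)$ a lattice of type $D_n$, and let $C$ be an $(\mathbb{F}_2\times\mathbb{F}_2)$-code of length $m$. Let $\Gamma_C=(\rho^{\oplus m})^{-1}(C)$ be the associated lattice with form $B$ (see context). (a) If $n\in2\mathbb{Z}$ and $n\notin4\mathbb{Z}$, then: 1. $\Gamma_C$ is integral if and only if $C\subset C^\perp$. 2. $\Gamma_C$ is unimodular if and only if $C$ is Euclidean self-dual. 3. $\Gamma_C$ is even if and only if $\mathrm{wt}_{\mathrm L}(x)\in4\mathbb{Z}$ for every $x\in C$. 4. $\Gamma_C$ is even unimodular if and only if $C$ is Type II. (b) If $n\in4\mathbb{Z}$ and $n\notin8\mathbb{Z}$, then: 1. $\Gamma_C$ is integral if and only if $C\subset\overline{C}^\perp$. 2. $\Gamma_C$ is unimodular if and only if $C$ is Hermitian self-dual. 3. $\Gamma_C$ is even if and only if $\mathrm{wt}_{\mathrm H}(x)\in2\mathbb{Z}$ for every $x\in C$. 4. $\Gamma_C$ is even unimodular if and only if $C$ is Type IV. (c) If $n\in8\mathbb{Z}$, then: 1. $\Gamma_C$ is integral if and only if $C\subset\overline{C}^\perp$. 2. $\Gamma_C$ is unimodular if and only if $C$ is Hermitian self-dual. 3. $\Gamma_C$ is even if and only if $C\subset\overline{C}^\perp$. 4. $\Gamma_C$ is even unimodular if and only if $C$ is Hermitian self-dual.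
   Context: **Lattices.** A lattice is a free $\mathbb{Z}$-module $\Lambda$ of finite rank with a positive-definite symmetric bilinear form $b$ to $\mathbb{R}$, extended to $\Lambda\otimes\mathbb{R}$; its dual is $\Lambda^*=\{x\in\Lambda\otimes\mathbb{R}: b(x,y)\in\mathbb{Z}\ \forall y\in\Lambda\}$. It is integral if $b$ is $\mathbb{Z}$-valued on it, even if it is integral and $b(x,x)\in2\mathbb{Z}$ for all $x$, unimodular if $\Lambda^*=\Lambda$. $\Lambda$ is of type $D_n$ ($n\ge4$) if it has a basis $(e_1,\dots,e_n)$ with $b(e_i,e_i)=2$, $b(e_i,e_j)=-1$ if ($|i-j|=1$ and $\{i,j\}\ne\{n-1,n\}$) or $\{i,j\}=\{n-2,n\}$, and $0$ otherwise. **Construction.** With such a basis, let $f_i=e_i$ for $1\le i\le n-1$, $f_n=e_n+\sum_{l=1}^{n-2}e_l$, and $f_i^*=\sum_{l=1}^n\frac14(n-2|i-l|)f_l$. Then $b(f_i,f_j^* )=\delta_{ij}$, $(f_i)$ is a basis of $\Lambda$ and $(f_i^* )$ is a basis of $\Lambda^*$. $\mathbb{F}_2\times\mathbb{F}_2$ is the ring with componentwise addition and multiplication. Define the additive homomorphism $\rho^{\oplus m}:(\Lambda^* )^{\oplus m}\to(\mathbb{F}_2\times\mathbb{F}_2)^{\oplus m}$ by $$\Big(\sum_{j=1}^n x_{ij}f_j^*\Big)_{1\le i\le m}\mapsto\Big(\textstyle\sum_{j=1}^{n/2}x_{i(2j-1)}\bmod 2,\ \sum_{j=1}^{n/2}x_{i(2j)}\bmod2\Big)_{1\le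 i\le m}\qquad(x_{ij}\in\mathbb{Z}).$$ For a code $C$ put $\Gamma_C=(\rho^{\oplus m})^{-1}(C)$, a lattice with form $B(x,y)=\sum_{i=1}^m b(x_i,y_i)$. **Codes.** An $(\mathbb{F}_2\times\mathbb{F}_2)$-code of length $m$ is an $(\mathbb{F}_2\times\mathbb{F}_2)$-submodule $C\subset(\mathbb{F}_2\times\mathbb{F}_2)^{\oplus m}$. With $x\cdot y=\sum x_iy_i$, $C^\perp=\{x:x\cdot y=0\ \forall y\in C\}$. Conjugation is $\overline{(a,b)}=(b,a)$ on $\mathbb{F}_2\times\mathbb{F}_2$, applied coordinatewise to vectors and codes; $\overline{C}^\perp=(\overline C)^\perp$. $C$ is Euclidean self-dual if $C=C^\perp$, Hermitian self-dual if $C=\overline{C}^\perp$. For $x\in(\mathbb{F}_2\times\mathbb{F}_2)^{\oplus m}$: $N_0(x)$ is the number of coordinates equal to $(0,0)$, $N_2(x)$ the number equal to $(1,1)$, $N_1(x)=m-N_0(x)-N_2(x)$; $\mathrm{wt}_{\mathrm H}=N_1+N_2$ (Hamming), $\mathrm{wt}_{\mathrm L}=N_1+2N_2$ (Lee). A Euclidean self-dual code is Type II if $\mathrm{wt}_{\mathrm L}(x)\in4\mathbb{Z}$ for all $x\in C$. A Hermitian self-dual code is Type IV if $\mathrm{wt}_{\mathrm H}(x)\in2\mathbb{Z}$ for all $x\in C$. *)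

(* Defs.v *)
From HB Require Import structures.
From mathcomp Require Import all_boot all_order all_algebra.
From mathcomp Require Import sesquilinear.
From mathcomp Require Import boolp classical_sets reals.

Set Implicit Arguments.
Unset Strict Implicit.
Unset Printing Implicit Defensive.

Import Order.TTheory GRing.Theory Num.Theory.
Local Open Scope ring_scope.

Section Lattices.
Variables (R : realType) (V : vectType R).
Implicit Types (L : set V) (b : V -> V -> R).

Definition Zspan n (e : n.-tuple V) : set V :=
  [set x | exists a : 'I_n -> int, x = \sum_(i < n) (a i)%:~R *: tnth e i]%classic.

(* A lattice is a subset L of a real vector space with an R-free Z-basis, so
   that L (x) R is its real span Rspan L.  *)
Definition is_Zbasis n L (e : n.-tuple V) : Prop := free e /\ L = Zspan e.

Definition Rspan L : set V :=
  [set x | exists2 s : seq V, (forall u, u \in s -> L u) & x \in <<s>>%VS]%classic.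

Definition dual_lattice L b : set V :=
  [set x | Rspan L x /\ forall y, L y -> b x y \is a Num.int]%classic.

Definition integral_lattice L b : Prop :=
  forall x y, L x -> L y -> b x y \is a Num.int.

Definition even_lattice L b : Prop :=
  integral_lattice L b /\
  forall x, L x -> exists k : int, b x x = (2 * k)%:~R.

Definition unimodular_lattice L b : Prop := dual_lattice L b = L.

(* Gram matrix of type D_n, with the indices i, j running from 1 to n.  *)
Definition Dn_adj (n i j : nat) : bool :=
  let is_pair k l := ((i == k) && (j == l)) || ((i == l) && (j == k)) in
  ((`|i - j|%N == 1%N) && ~~ is_pair (n - 1)%N n) || is_pair (n - 2)%N n.

Definition Dn_gram (n i j : nat) : R :=
  if i == j then 2 else if Dn_adj n i j then -1 else 0.

(* Ordinals start at 0, so i : 'I_n stands for the index i.+1 of the usual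
   1-based numbering, here and in fvec and rho.  The span condition says
   that the ambient space V is L (x) R.  *)
Definition is_Dn_basis n L b (e : n.-tuple V) : Prop :=
  [/\ is_Zbasis L e, <<e>>%VS = fullv &
      forall i j : 'I_n, b (tnth e i) (tnth e j) = Dn_gram n i.+1 j.+1].

Definition fvec n (e : n.-tuple V) (i : 'I_n) : V :=
  if i.+1 == n then tnth e i + \sum_(l < n | (l.+1 <= n - 2)%N) tnth e l
  else tnth e i.

Definition fstar n (e : n.-tuple V) (i : 'I_n) : V :=
  \sum_(l < n) ((n%:R - 2 * `|i - l|%N%:R) / 4 : R) *: fvec e l.

(* The coefficients x_j of x = \sum_j x_j f_j^*.  For x in the dual lattice they
   are integers, and there Num.floor is only the cast from R to int.  *)
Definition fstar_coord n (e : n.-tuple V) (j : 'I_n) (x : V) : int :=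
  Num.floor (coord [tuple fstar e i | i < n] j x).

End Lattices.

(* The product ring F_2 x F_2, with componentwise operations.  *)
Notation F2F2 := ('F_2 * 'F_2)%type.

Section Codes.
Variable m : nat.
Implicit Types (C : {set 'rV[F2F2]_m}) (x y : 'rV[F2F2]_m).

Definition is_code C : Prop := submod_closed C.

Definition dotp x y : F2F2 := \sum_(i < m) x 0 i * y 0 i.

Definition dual_code C : {set 'rV[F2F2]_m} :=
  [set x | [forall y in C, dotp x y == 0]].

Definition conj_vec x : 'rV[F2F2]_m := map_mx (fun a : F2F2 => (a.2, a.1)) x.

Definition conj_code C : {set 'rV[F2F2]_m} := [set conj_vec x | x in C].

Definition herm_dual_code C : {set 'rV[F2F2]_m} := dual_code (conj_code C).

Definition euclidean_self_dual C : Prop := C = dual_code C.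
Definition hermitian_self_dual C : Prop := C = herm_dual_code C.

Definition N0 x : nat := #|[set i : 'I_m | x 0 i == (0, 0)]|.
Definition N2 x : nat := #|[set i : 'I_m | x 0 i == (1, 1)]|.
Definition N1 x : nat := (m - N0 x - N2 x)%N.

Definition wtH x : nat := (N1 x + N2 x)%N.
Definition wtL x : nat := (N1 x + 2 * N2 x)%N.

Definition type_II C : Prop :=
  euclidean_self_dual C /\ forall x, x \in C -> (4 %| wtL x)%N.
Definition type_IV C : Prop :=
  hermitian_self_dual C /\ forall x, x \in C -> (2 %| wtH x)%N.

End Codes.

Section ConstructionA.
Variables (R : realType) (V : vectType R) (n m : nat).
Implicit Types (L : set V) (b : V -> V -> R) (e : n.-tuple V).

Definition rho e (x : {ffun 'I_m -> V}) : 'rV[F2F2]_m :=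
  \row_(i < m) (\sum_(j < n | odd j.+1) (fstar_coord e j (x i))%:~R : 'F_2,
                \sum_(j < n | ~~ odd j.+1) (fstar_coord e j (x i))%:~R : 'F_2).

Definition sum_form b (x y : {ffun 'I_m -> V}) : R := \sum_(i < m) b (x i) (y i).

Definition Gamma L b e (C : {set 'rV[F2F2]_m}) : set {ffun 'I_m -> V} :=
  [set x : {ffun 'I_m -> V} | (forall i, dual_lattice L b (x i)) /\ rho e x \in C]%classic.

End ConstructionA.

(* Main.v *)
Require Import Defs.
From mathcomp Require Import all_boot all_order all_algebra.
From mathcomp Require Import sesquilinear.
From mathcomp Require Import boolp classical_sets reals.
From mathcomp Require Import zify ring.

Set Implicit Arguments.
Unset Strict Implicit.
Unset Printing Implicit Defensive.

Import Order.TTheory GRing.Theory Num.Theory.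
Local Open Scope ring_scope.

(** Realise the lattice in orthonormal coordinates as the D_n root lattice:
    e_i = eps_i - eps_(i+1) for i < n and e_n = eps_(n-1) + eps_n
    ([dot_ocoord]).  Then f_i = eps_i - eps_(i+1) for i < n, f_n = eps_n + eps_1,
    and f_i^* = (eps_1 + .. + eps_i - eps_(i+1) - .. - eps_n) / 2, so that
    b(f_i, f_j^* ) = delta_ij and b(f_i^*, f_j^* ) = (n - 2 |i - j|) / 4.
    Hence the dual lattice consists of the vectors with integral pairings
    b(x, f_j), and these pairings are the coordinates of x on the f_j^*.

    For x in the dual lattice let A and B be the sums of its coordinates of odd
    and of even index; rho reduces the pair (A, B) modulo 2.  The Gram matrix
    of the f_j^* depends on j and k through |j - k|, whose parity only sees the
    parities of j and k.  This gives
      4 b(x, x') = n (A + B)(A' + B') - 2 (A B' + B A')  modulo 4,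
      4 b(x, x)  = n (A + B)^2 - 4 A B                   modulo 8
    ([Qform_polar], [Qform_diag]).  If n = 2 modulo 4, the first right-hand
    side is 2 (A A' + B B') modulo 4; if 4 divides n, it is 2 (A B' + B A').
    Summing over the coordinates, x and y have an integral pairing if and only
    if the two components of rho x . rho y (in the first case), or of the
    product of rho x with the conjugate of rho y (in the second), have sum 0
    ([sum_form_int]).  A code is stable under (1, 0) and (0, 1), so vanishing
    of this sum against a whole code is orthogonality to the code
    ([trdot_perp]).

    Moreover f_j lies in the kernel of rho ([rho_fvec]), so a vector with
    integral pairings against Gamma_C has all its components in the dual
    lattice; it follows that the dual of Gamma_C is Gamma_D for the Euclidean
    or Hermitian dual D of C ([dual_Gamma]).  As rho is surjective, this
    settles integrality and unimodularity.

    For evenness it suffices by polarization to look at norms ([even_norms]),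
    and the second congruence identifies the norm modulo 2 with: half the Lee
    weight up to an odd factor when n = 2 modulo 4, since squares count odd
    entries modulo 4; the Hamming weight when n = 4 modulo 8, since
    A^2 + A B + B^2 is even only if A and B both are; and the sum of the
    products A B when 8 divides n, which is even as soon as rho x is orthogonal
    to its own conjugate. *)

(** * Integral quadratic forms modulo 2, 4 and 8 *)

(** The terms (j, k) and (k, j) pair up. *)
Lemma even_sym_sum n (F : 'I_n -> 'I_n -> int) :
  (forall j k, F j k = F k j) -> (forall j, F j j = 0) ->
  exists t, \sum_j \sum_k F j k = 2 * t.
Proof.
move=> Fsym F0; exists (\sum_(j < n) \sum_(k < n | (k < j)%N) F j k).
transitivity (\sum_(j < n) \sum_(k < n | (k < j)%N) F j k +
              \sum_(j < n) \sum_(k < n | (j < k)%N) F j k).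
  rewrite -big_split; apply: eq_bigr => j _ /=.
  rewrite 2!(big_mkcond (fun _ => leq _ _)) -big_split.
  apply: eq_bigr => k _ /=.
  case: ltngtP => [_|_|/val_inj ->]; rewrite ?addr0 ?add0r ?F0 //.
rewrite [X in _ + X](exchange_big_dep xpredT) //=.
under [X in _ + X]eq_bigr do under eq_bigr do rewrite Fsym.
by ring.
Qed.

(** Ordinals start at 0, so [odd j.+1] selects the odd positions in the usual
    numbering from 1. *)
Definition odd_sum n (z : 'I_n -> int) : int := \sum_(j < n | odd j.+1) z j.
Definition even_sum n (z : 'I_n -> int) : int := \sum_(j < n | ~~ odd j.+1) z j.

Lemma odd_even_sum n (z : 'I_n -> int) : \sum_j z j = odd_sum z + even_sum z.
Proof. exact: (bigID (fun j : 'I_n => odd j.+1)). Qed.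

(** |j - k| is odd exactly when j and k have opposite parities; the pairs of
    opposite parity sum up to the mixed products, and the rest is even. *)
Lemma dist_sum n (z w : 'I_n -> int) :
  \sum_j \sum_k z j * w k * `|j - k|%N%:Z =
  odd_sum z * even_sum w + even_sum z * odd_sum w
  + 2 * \sum_j \sum_k z j * w k * (`|j - k|./2)%N%:Z.
Proof.
rewrite /odd_sum /even_sum.
rewrite !(big_mkcond (fun _ => odd _)) !(big_mkcond (fun _ => ~~ _)).
rewrite /= !mulr_suml mulr_sumr -!big_split; apply: eq_bigr => j _ /=.
rewrite !mulr_sumr -!big_split; apply: eq_bigr => k _ /=.
rewrite -[in LHS](odd_double_half `|j - k|).
rewrite (_ : odd _ = odd j (+) odd k); last lia.
by case: (odd j); case: (odd k) => /=; lia.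
Qed.

(** Four times the Gram form of the f_j^*, see [dot_dual]. *)
Definition Qform n (z w : 'I_n -> int) : int :=
  n%:Z * (odd_sum z + even_sum z) * (odd_sum w + even_sum w)
  - 2 * \sum_j \sum_k z j * w k * `|j - k|%N%:Z.

Lemma Qform_polar n (z w : 'I_n -> int) : exists t,
  Qform z w = n%:Z * (odd_sum z + even_sum z) * (odd_sum w + even_sum w)
  - 2 * (odd_sum z * even_sum w + even_sum z * odd_sum w) + 4 * t.
Proof.
exists (- (\sum_j \sum_k z j * w k * (`|j - k|./2)%N%:Z)).
by rewrite /Qform dist_sum; ring.
Qed.

(** On the diagonal the even remainder of [dist_sum] gains one more factor 2:
    its kernel is symmetric and vanishes for j = k. *)
Lemma Qform_diag n (z : 'I_n -> int) : exists t,
  Qform z z = n%:Z * (odd_sum z + even_sum z) ^+ 2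
  - 4 * (odd_sum z * even_sum z) + 8 * t.
Proof.
have [j k|j|t Et] := @even_sym_sum n (fun j k => z j * z k * (`|j - k|./2)%N%:Z).
- by rewrite distnC [z j * _]mulrC.
- by rewrite distnn mulr0.
by exists (- t); rewrite /Qform dist_sum Et; ring.
Qed.

Lemma quarter_int (R : realType) (r : R) (k : int) : 4 * r = k%:~R ->
  (r \is a Num.int <-> (4 %| k)%Z).
Proof.
move=> Er; split=> [/intrP[c Ec]|/dvdzP[c Ec]].
  apply/dvdzP; exists c; apply: (@intr_inj R); rewrite -Er Ec rmorphM /=; ring.
apply/intrP; exists c; apply: (@mulfI _ 4); first by rewrite pnatr_eq0.
by rewrite Er Ec rmorphM /=; ring.
Qed.

Lemma quarter_even (R : realType) (r : R) (k : int) : 4 * r = k%:~R ->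
  ((exists c : int, r = (2 * c)%:~R) <-> (8 %| k)%Z).
Proof.
move=> Er; split=> [[c Ec]|/dvdzP[c Ec]].
  apply/dvdzP; exists c; apply: (@intr_inj R); rewrite -Er Ec !rmorphM /=; ring.
exists c; apply: (@mulfI _ 4); first by rewrite pnatr_eq0.
by rewrite Er Ec !rmorphM /=; ring.
Qed.

Lemma sqr_mod4 (k : int) : exists t, k ^+ 2 = (~~ (2 %| k)%Z)%:Z + 4 * t.
Proof.
case: (boolP (2 %| k)%Z) => [/dvdzP[c ->]|nk].
  by exists (c ^+ 2); rewrite /=; ring.
have [c ->] : exists c, k = 2 * c + 1 by exists (k %/ 2)%Z; lia.
by exists (c ^+ 2 + c); rewrite /=; ring.
Qed.

Lemma F2_int_eq0 (k : int) : (k%:~R == 0 :> 'F_2) = (2 %| k)%Z.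
Proof. by rewrite -(dvdz_pcharf (pchar_Fp (isT : prime 2))). Qed.

(** Two positions of the same parity cancel in characteristic 2 in whichever of
    the two partial sums they fall. *)
Lemma parity_sum_pair n (F : 'I_n -> 'F_2) p q :
  (p < n)%N -> (q < n)%N -> odd p = odd q ->
  (forall j : 'I_n, F j = (j == p :> nat)%:R + (j == q :> nat)%:R) ->
  \sum_(j < n | odd j.+1) F j = 0 /\ \sum_(j < n | ~~ odd j.+1) F j = 0.
Proof.
move=> lp lq opq EF.
have E r (P : pred nat) : (r < n)%N ->
    \sum_(j < n | P j) (j == r :> nat)%:R = (P r)%:R :> 'F_2.
  move=> lr; rewrite big_mkcond (bigD1 (Ordinal lr)) //= eqxx big1 ?addr0.
    by case: (P r).
  by move=> j; rewrite -val_eqE => /negbTE /= ->; rewrite if_same.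
by split; under eq_bigr do rewrite EF; rewrite big_split /=;
  [rewrite !(E _ (fun j => odd j.+1)) | rewrite !(E _ (fun j => ~~ odd j.+1))] => //=;
  rewrite opq; case: (odd q); apply/eqP.
Qed.

(** * Codes over F_2 x F_2 *)

Section Codes.
Variable m : nat.
Implicit Types (C : {set 'rV[F2F2]_m}) (x y : 'rV[F2F2]_m).

(** The boolean [herm] treats both dualities at once: the Hermitian dual is the
    Euclidean one twisted by conjugation. *)
Definition twist herm x := if herm then conj_vec x else x.
Definition perp herm C := if herm then herm_dual_code C else dual_code C.

Lemma dotp1 x y : (dotp x y).1 = \sum_i (x 0 i).1 * (y 0 i).1.
Proof. by rewrite /dotp (big_morph fst (id1 := 0) (op1 := +%R)). Qed.

Lemma dotp2 x y : (dotp x y).2 = \sum_i (x 0 i).2 * (y 0 i).2.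
Proof. by rewrite /dotp (big_morph snd (id1 := 0) (op1 := +%R)). Qed.

Lemma mem_perp herm C x :
  x \in perp herm C <-> forall y, y \in C -> dotp x (twist herm y) = 0.
Proof.
rewrite /perp /twist; case: herm; rewrite !inE; split.
- by move=> /forall_inP H y yC; apply/eqP/H/imset_f.
- by move=> H; apply/forall_inP => _ /imsetP[y yC ->]; apply/eqP/H.
- by move=> /forall_inP H y yC; apply/eqP/H.
- by move=> H; apply/forall_inP => y yC; apply/eqP/H.
Qed.

(** The trace of F_2 x F_2 over F_2, applied to the product; this is the part of
    the product that the lattice form sees. *)
Definition trdot herm x y : 'F_2 :=
  (dotp x (twist herm y)).1 + (dotp x (twist herm y)).2.

Lemma code_scale C (r : F2F2) x : is_code C -> x \in C -> r *: x \in C.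
Proof. by move=> [C0 CL] xC; rewrite -[_ *: _]addr0 CL. Qed.

Lemma dotp_twistZ herm (r : F2F2) x y :
  dotp x (twist herm (r *: y))
  = (if herm then (r.2, r.1) else r) * dotp x (twist herm y).
Proof.
rewrite /dotp mulr_sumr; apply: eq_bigr => i _; rewrite mulrCA.
by case: herm; rewrite /= !mxE.
Qed.

(** Scaling y by the idempotents (1, 0) and (0, 1), which conjugation only
    exchanges, isolates the two components of the product. *)
Lemma trdot_perp herm C x : is_code C ->
  (forall y, y \in C -> trdot herm x y = 0) <-> x \in perp herm C.
Proof.
move=> hC; rewrite mem_perp; split=> H y yC; last by rewrite /trdot H ?addr0.
have := H _ (code_scale (1, 0) hC yC); have := H _ (code_scale (0, 1) hC yC).
rewrite /trdot !dotp_twistZ; case: (dotp _ _) => a c.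
by case: (herm) => /=; rewrite !mul1r !mul0r ?addr0 ?add0r => -> ->.
Qed.

Lemma trdotE herm x y : trdot herm x y =
  \sum_i if herm then (x 0 i).1 * (y 0 i).2 + (x 0 i).2 * (y 0 i).1
         else (x 0 i).1 * (y 0 i).1 + (x 0 i).2 * (y 0 i).2.
Proof.
rewrite /trdot dotp1 dotp2 -big_split; apply: eq_bigr => i _ /=.
by case: herm => //=; rewrite !mxE.
Qed.

Lemma N0E x : N0 x = (\sum_(i < m) (x 0%R i == (0, 0)%R))%N.
Proof. by rewrite /N0 -sum1dep_card big_mkcond. Qed.

Lemma N2E x : N2 x = (\sum_(i < m) (x 0%R i == (1, 1)%R))%N.
Proof. by rewrite /N2 -sum1dep_card big_mkcond. Qed.

Lemma N1E x : N1 x =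
  (\sum_(i < m) ((x 0%R i != (0, 0)%R) && (x 0%R i != (1, 1)%R)))%N.
Proof.
rewrite /N1 N0E N2E.
rewrite -[X in (X - _ - _)%N](card_ord m) -sum1_card.
rewrite (_ : \sum_(i in 'I_m) 1 = \sum_(i < m) (x 0%R i == (0, 0)%R : nat) +
   \sum_(i < m) (x 0%R i == (1, 1)%R : nat) +
   \sum_(i < m) ((x 0%R i != (0, 0)%R) && (x 0%R i != (1, 1)%R)))%N; last first.
  rewrite -!big_split; apply: eq_bigr => i _ /=.
  by case: eqP => [->|_]; case: eqP.
by rewrite -addnA addKn addKn.
Qed.

Lemma F2_cases (a : 'F_2) : a = 0 \/ a = 1.
Proof. by case: a => [[|[|]]] // i; [left | right]; apply: val_inj. Qed.

Lemma wtLE x :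
  wtL x = (\sum_(i < m) (((x 0%R i).1 != 0%R) + ((x 0%R i).2 != 0%R)))%N.
Proof.
rewrite /wtL N1E N2E big_distrr -big_split; apply: eq_bigr => i _ /=.
case: (x 0 i) => a c /=.
by case: (F2_cases a) (F2_cases c) => -> [] ->.
Qed.

Lemma wtHE x :
  wtH x = (\sum_(i < m) (((x 0%R i).1 != 0%R) || ((x 0%R i).2 != 0%R)))%N.
Proof.
rewrite /wtH N1E N2E -big_split; apply: eq_bigr => i _ /=.
case: (x 0 i) => a c /=.
by case: (F2_cases a) (F2_cases c) => -> [] ->.
Qed.

End Codes.

(** * Orthonormal coordinates on a lattice of type D_n *)

Section DnLattice.
Variables (R : realType) (V : vectType R) (n : nat).
Variables (L : set V) (b : {dot V for idfun}) (e : n.-tuple V).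
Hypotheses (hn4 : (4 <= n)%N) (hn : ~~ odd n) (hL : is_Dn_basis L b e).

(** The k-th coordinate of e_i in an orthonormal basis eps, the indices running
    from 0 to n - 1: eps_i - eps_(i+1), except eps_(n-1) + eps_(n-2) for
    i = n - 1. *)
Definition Dn_root (i k : nat) : R :=
  if i.+1 == n then (k == i)%:R + (k == i.-1)%:R
  else (k == i)%:R - (k == i.+1)%:R.

Lemma sum_delta (i : nat) (g : nat -> R) : (i < n)%N ->
  \sum_(k < n) (k == i :> nat)%:R * g k = g i.
Proof.
move=> lin; rewrite (bigD1 (Ordinal lin)) //= eqxx mul1r big1 ?addr0 // => k.
by rewrite -val_eqE /= => /negbTE ->; rewrite mul0r.
Qed.

Lemma Dn_root_pairing (i : nat) (g : nat -> R) : (i < n)%N ->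
  \sum_(k < n) Dn_root i k * g k =
  if i.+1 == n then g i + g i.-1 else g i - g i.+1.
Proof.
move=> lin; rewrite /Dn_root; case: eqP => [Ein|/eqP nin].
  under eq_bigr do rewrite mulrDl.
  by rewrite big_split /= !sum_delta //; lia.
under eq_bigr do rewrite mulrBl.
by rewrite sumrB !sum_delta //; lia.
Qed.

(** A comparison of the finitely many ways in which the indices can coincide. *)
Lemma Dn_root_gram (i j : nat) : (i < n)%N -> (j < n)%N ->
  \sum_(k < n) Dn_root i k * Dn_root j k = Dn_gram R n i.+1 j.+1.
Proof.
move=> lin ljn; rewrite Dn_root_pairing // /Dn_root /Dn_gram /Dn_adj.
have -> : (`|i.+1 - j.+1|%N == 1%N) = (i == j.+1) || (j == i.+1) by lia.
by do !case: eqP => /= ?; first [lia | ring | idtac].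
Qed.

(** The coordinates of x on eps, extended linearly from the e_i. *)
Definition ocoord (x : V) (k : nat) : R :=
  \sum_(i < n) coord e i x * Dn_root i k.

Lemma ocoord_sum (I : finType) (P : pred I) (c : I -> R) (v : I -> V) k :
  ocoord (\sum_(i | P i) c i *: v i) k = \sum_(i | P i) c i * ocoord (v i) k.
Proof.
rewrite /ocoord; under eq_bigr do rewrite linear_sum mulr_suml.
rewrite exchange_big; apply: eq_bigr => i _; rewrite mulr_sumr.
by apply: eq_bigr => j _; rewrite linearZ /= mulrA.
Qed.

Lemma ocoordD x y k : ocoord (x + y) k = ocoord x k + ocoord y k.
Proof.
by rewrite -big_split; apply: eq_bigr => j _; rewrite linearD /= mulrDl.
Qed.

Lemma ocoord_basis (i : 'I_n) k : ocoord (tnth e i) k = Dn_root i k.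
Proof.
case: hL => -[fe _] _ _; rewrite /ocoord (bigD1 i) //= big1 => [|j nij].
  by rewrite (tnth_nth 0) coord_free // eqxx mul1r addr0.
by rewrite (tnth_nth 0) coord_free // eq_sym (negbTE nij) mul0r.
Qed.

Lemma dot_sumr (I : finType) (P : pred I) (c : I -> R) (v : I -> V) x :
  b x (\sum_(i | P i) c i *: v i) = \sum_(i | P i) c i * b x (v i).
Proof.
by rewrite linear_sumr; apply: eq_bigr => i _; rewrite linearZr_LR.
Qed.

Lemma dotC x y : b x y = b y x.
Proof. by rewrite hermC expr0 mul1r. Qed.

Lemma dot_suml (I : finType) (P : pred I) (c : I -> R) (v : I -> V) x :
  b (\sum_(i | P i) c i *: v i) x = \sum_(i | P i) c i * b (v i) x.
Proof. by rewrite dotC dot_sumr; apply: eq_bigr => i _; rewrite dotC. Qed.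

Lemma basis_expansion x : x = \sum_i coord e i x *: tnth e i.
Proof.
case: hL => -[fe _] se _.
rewrite {1}(@coord_span _ _ _ e x) ?se ?memvf //.
by apply: eq_bigr => i _; rewrite (tnth_nth 0).
Qed.

Lemma dot_ocoord x y : b x y = \sum_(k < n) ocoord x k * ocoord y k.
Proof.
case: (hL) => _ _ gram.
rewrite {1}(basis_expansion x) {1}(basis_expansion y) dot_suml.
under eq_bigr => i _.
  rewrite dot_sumr.
  under eq_bigr => j _ do rewrite gram -Dn_root_gram //.
  over.
rewrite /ocoord /=.
under [RHS]eq_bigr => k _ do rewrite mulr_suml.
rewrite [RHS]exchange_big /=; apply: eq_bigr => i _.
rewrite mulr_sumr.
under [RHS]eq_bigr => k _ do rewrite mulr_sumr.
rewrite exchange_big /=; apply: eq_bigr => j _.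
rewrite !mulr_sumr; apply: eq_bigr => k _; ring.
Qed.

(** The coordinates of f_i: the sum in the definition of f_n telescopes, and the
    f_i become differences around a cycle with one sign changed, where
    f_(n-1) = eps_(n-1) + eps_0 closes the cycle. *)
Definition cyc_root (i k : nat) : R :=
  if i.+1 == n then (k == i)%:R + (k == 0%N)%:R
  else (k == i)%:R - (k == i.+1)%:R.

Lemma ocoord_fvec (i : 'I_n) k : ocoord (fvec e i) k = cyc_root i k.
Proof.
rewrite /fvec /cyc_root; case: eqP => [En|/eqP nEn]; last first.
  by rewrite ocoord_basis /Dn_root (negbTE nEn).
under eq_bigr do rewrite -[tnth _ _]scale1r.
rewrite ocoordD ocoord_sum ocoord_basis /Dn_root En eqxx.
transitivity ((k == i)%:R + (k == i.-1)%:R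
    + \sum_(0 <= l < n - 2) ((k == l)%:R - (k == l.+1)%:R) : R).
  congr (_ + _); rewrite big_mkord.
  rewrite (big_ord_widen n (fun l => (k == l)%:R - (k == l.+1)%:R)); last lia.
  apply: eq_bigr => l ll; rewrite mul1r ocoord_basis /Dn_root ifF //.
  by apply/negP => /eqP; lia.
rewrite (telescope_sumr_eq (fun l => - (k == l)%:R)) //; last first.
  by move=> l _; ring.
by rewrite (_ : i.-1 = n - 2)%N; [ring | lia].
Qed.

Lemma cyc_root_pairing (i : nat) (g : nat -> R) : (i < n)%N ->
  \sum_(k < n) cyc_root i k * g k =
  if i.+1 == n then g i + g 0%N else g i - g i.+1.
Proof.
move=> lin; rewrite /cyc_root; case: eqP => [Ein|/eqP nin].
  under eq_bigr do rewrite mulrDl.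
  by rewrite big_split /= !sum_delta //; lia.
under eq_bigr do rewrite mulrBl.
by rewrite sumrB !sum_delta //; lia.
Qed.

(** Summation by parts, to read off the coordinates of a combination of the
    f_l. *)
Lemma cyc_root_comb (k : nat) (c : nat -> R) : (k < n)%N ->
  \sum_(l < n) c l * cyc_root l k =
  if k == 0%N then c 0%N + c n.-1 else c k - c k.-1.
Proof.
move=> lkn.
transitivity (\sum_(l < n) ((l == k :> nat)%:R * c l
  + (l == n.-1 :> nat)%:R * ((k == 0%N)%:R * c l)
  - (if k == 0%N then 0 else (l == k.-1 :> nat)%:R * c l))).
  apply: eq_bigr => l _; have := ltn_ord l; rewrite /cyc_root => lln.
  have -> : (l == n.-1 :> nat) = (l.+1 == n) by apply/eqP/eqP; lia.
  rewrite (eq_sym k l).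
  case: (eqVneq k 0%N) => [->|k0]; first by case: eqP => _; rewrite /=; ring.
  have -> : (l == k.-1 :> nat) = (k == l.+1) by apply/eqP/eqP; lia.
  case: eqP => [El|_]; last by rewrite /=; ring.
  have -> : (k == l.+1) = false by apply/eqP; lia.
  by rewrite /=; ring.
rewrite sumrB big_split /= (sum_delta c) //.
rewrite (sum_delta (fun j => (k == 0%N)%:R * c j)); last lia.
case: eqP => [-> | _]; first by rewrite big1 //=; ring.
by rewrite (sum_delta c) /=; [ring | lia].
Qed.

(** The coordinates of f_i^*. *)
Definition half_sign (i k : nat) : R :=
  if (k <= i)%N then 1 / 2 else - (1 / 2).

Lemma ocoord_fstar (i : 'I_n) k :
  (k < n)%N -> ocoord (fstar e i) k = half_sign i k.
Proof.
move=> lkn; rewrite /fstar ocoord_sum.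
under eq_bigr do rewrite ocoord_fvec.
rewrite (cyc_root_comb (fun l => (n%:R - 2 * `|i - l|%N%:R) / 4)) // /half_sign.
have lin := ltn_ord i.
case: eqP => [->|k0].
  have -> : `|i - 0%N|%N = i by lia.
  have -> : `|i - n.-1|%N = (n.-1 - i)%N by lia.
  have -> : n%:R = (n.-1 - i)%:R + i%:R + 1 :> R.
    by rewrite -natrD natr1; congr (_%:R); lia.
  by rewrite leq0n; field.
case: leqP => ki.
  have -> : `|i - k|%N = (i - k)%N by lia.
  have -> : `|i - k.-1|%N = (i - k + 1)%N by lia.
  by rewrite natrD; field.
have -> : `|i - k|%N = (k - i.+1 + 1)%N by lia.
have -> : `|i - k.-1|%N = (k - i.+1)%N by lia.
by rewrite natrD; field.
Qed.

(** Consecutive coordinates of f_j^* agree except at the sign change after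
    position j; at the closing vertex of the cycle the first coordinate is 1/2
    and the last one is -1/2, unless j is the last index. *)
Lemma dot_fvec_fstar i j : b (fvec e i) (fstar e j) = (i == j)%:R :> R.
Proof.
rewrite dot_ocoord.
under eq_bigr => k _ do rewrite ocoord_fvec ocoord_fstar //.
rewrite (cyc_root_pairing (half_sign j)) // /half_sign -val_eqE /=.
have := ltn_ord i; have := ltn_ord j.
case: (eqVneq (i : nat) j) => [->|nij] ? ? /=; last first.
  case: eqP => ?; first by rewrite ifF ?addNr //; lia.
  case: (leqP i j) => ?; first by rewrite ifT ?subrr //; lia.
  by rewrite ifF ?subrr //; lia.
rewrite leqnn ltnn /=; case: ifP => _; first by field.
by rewrite opprK; field.
Qed.

Lemma dot_fvec (i j : 'I_n) : b (fvec e i) (fvec e j) =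
  if i.+1 == n then cyc_root j i + cyc_root j 0%N
  else cyc_root j i - cyc_root j i.+1 :> R.
Proof.
rewrite dot_ocoord; under eq_bigr => k _ do rewrite !ocoord_fvec.
by rewrite (cyc_root_pairing (cyc_root j)).
Qed.

(** By duality this is the coefficient of f_j in f_i^*. *)
Lemma dot_fstar i j :
  b (fstar e i) (fstar e j) = (n%:R - 2 * `|i - j|%N%:R) / 4 :> R.
Proof.
rewrite {1}/fstar dot_suml (bigD1 j) //= dot_fvec_fstar eqxx mulr1.
by rewrite big1 ?addr0 // => k nkj; rewrite dot_fvec_fstar (negbTE nkj) mulr0.
Qed.

(** * The dual lattice in coordinates *)

(** Independence follows by pairing with the f_i, and n independent vectors span
    since V has the basis e. *)
Lemma fstar_basis : basis_of fullv [tuple fstar e i | i < n].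
Proof.
case: (hL) => -[fe _] se _; rewrite basisEfree subvf size_tuple -se.
rewrite (eqP fe : \dim <<e>> = size e) size_tuple leqnn !andbT.
apply/freeP => k k0 i; have := congr1 (b (fvec e i)) k0.
rewrite (eq_bigr (fun j => k j *: fstar e j)) => [|j _]; last first.
  by rewrite nth_mktuple.
rewrite dot_sumr linear0r (bigD1 i) //= dot_fvec_fstar eqxx mulr1.
rewrite big1 ?addr0 // => j nji.
by rewrite dot_fvec_fstar eq_sym (negbTE nji) mulr0.
Qed.

Lemma coord_fstar j x : coord [tuple fstar e i | i < n] j x = b x (fvec e j).
Proof.
rewrite [in RHS](coord_basis fstar_basis (memvf x)) dot_suml (bigD1 j) //=.
rewrite nth_mktuple dotC dot_fvec_fstar eqxx mulr1.
rewrite big1 ?addr0 // => i nij.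
rewrite nth_mktuple dotC dot_fvec_fstar.
by rewrite eq_sym (negbTE nij) mulr0.
Qed.

Lemma fstar_expansion x : x = \sum_j b x (fvec e j) *: fstar e j.
Proof.
rewrite {1}(coord_basis fstar_basis (memvf x)); apply: eq_bigr => j _.
by rewrite coord_fstar nth_mktuple.
Qed.

(** Inverts the definition of the f_i, so that they generate the same lattice as
    the e_i. *)
Lemma basis_fvec (i : 'I_n) :
  tnth e i = fvec e i - (if i.+1 == n then
    \sum_(l < n | (l.+1 <= n - 2)%N) fvec e l else 0).
Proof.
rewrite {1}/fvec; case: eqP => [_|_]; last by rewrite subr0.
rewrite (eq_bigr (fvec e)) ?addrK // => l ll; rewrite /fvec ifF //.
by apply/eqP; lia.
Qed.

Lemma lattice_basis i : L (tnth e i).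
Proof.
case: (hL) => -[_ ->] _ _; exists (fun j => (j == i)%:Z).
rewrite (bigD1 i) //= eqxx scale1r big1 ?addr0 // => j /negbTE ->.
by rewrite scale0r.
Qed.

Lemma lattice_int x : (forall i, b x (tnth e i) \is a Num.int) ->
  forall y, L y -> b x y \is a Num.int.
Proof.
case: (hL) => -[_ ->] _ _ bx _ [a ->]; rewrite dot_sumr.
by apply: rpred_sum => i _; rewrite rpredM // intr_int.
Qed.

Lemma latticeD x y : L x -> L y -> L (x + y).
Proof.
case: (hL) => -[_ ->] _ _ [a ->] [c ->]; exists (fun i => a i + c i).
by rewrite -big_split; apply: eq_bigr => i _; rewrite rmorphD scalerDl.
Qed.

Lemma lattice0 : L 0.
Proof.
case: (hL) => -[_ ->] _ _; exists (fun i => 0).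
by rewrite big1 // => i _; rewrite scale0r.
Qed.

Lemma lattice_fvec i : L (fvec e i).
Proof.
rewrite /fvec; case: ifP => _; last exact: lattice_basis.
apply: latticeD; first exact: lattice_basis.
elim/big_ind: _ => [|x y|j _]; [exact: lattice0 | exact: latticeD |].
exact: lattice_basis.
Qed.

Lemma Rspan_lattice x : Rspan L x.
Proof.
exists e; first by move=> u /tnthP[i ->]; exact: lattice_basis.
by case: (hL) => _ -> _; exact: memvf.
Qed.

Lemma dual_latticeP x :
  dual_lattice L b x <-> forall j, b x (fvec e j) \is a Num.int.
Proof.
split=> [[_ xL] j|xf]; first by apply: xL; exact: lattice_fvec.
split; first exact: Rspan_lattice.
apply: lattice_int => i; rewrite basis_fvec linearBr.
apply: rpredB; first exact: xf.
case: ifP => _; last by rewrite linear0r; exact: rpred0.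
by rewrite linear_sumr; apply: rpred_sum => l _; exact: xf.
Qed.

(** On the dual lattice the floor in [fstar_coord] is taken of an integer. *)
Lemma dual_coord x j : dual_lattice L b x ->
  (fstar_coord e j x)%:~R = b x (fvec e j).
Proof.
by move=> /dual_latticeP xf; rewrite /fstar_coord coord_fstar floorK // inE xf.
Qed.

Lemma dual_expansion x : dual_lattice L b x ->
  x = \sum_j (fstar_coord e j x)%:~R *: fstar e j.
Proof.
move=> dx; rewrite {1}[x]fstar_expansion; apply: eq_bigr => j _.
by rewrite dual_coord.
Qed.

Lemma dot_dual x y : dual_lattice L b x -> dual_lattice L b y ->
  4 * b x y =
  (Qform (fun j => fstar_coord e j x) (fun j => fstar_coord e j y))%:~R.
Proof.
move=> dx dy; rewrite {1}(dual_expansion dx) {1}(dual_expansion dy).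
rewrite dot_suml mulr_sumr /Qform -!odd_even_sum.
rewrite rmorphB !rmorphM /= !rmorph_sum /= -mulrA mulr_suml !mulr_sumr -sumrB.
apply: eq_bigr => j _; rewrite rmorph_sum dot_sumr !mulr_sumr -sumrB /=.
apply: eq_bigr => k _; rewrite dot_fstar !rmorphM /=.
by field.
Qed.

Lemma dualD x y : dual_lattice L b x -> dual_lattice L b y ->
  dual_lattice L b (x + y).
Proof.
move=> /dual_latticeP dx /dual_latticeP dy; apply/dual_latticeP => j.
by rewrite linearDl; apply: rpredD; [exact: dx | exact: dy].
Qed.

Lemma dual_comb (z : 'I_n -> int) (x := \sum_j (z j)%:~R *: fstar e j) :
  dual_lattice L b x /\ forall j, fstar_coord e j x = z j.
Proof.
have E j : b x (fvec e j) = (z j)%:~R.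
  rewrite dot_suml (bigD1 j) //= dotC dot_fvec_fstar eqxx mulr1.
  rewrite big1 ?addr0 // => i nij; rewrite dotC dot_fvec_fstar.
  by rewrite eq_sym (negbTE nij) mulr0.
have dx : dual_lattice L b x by apply/dual_latticeP => j; rewrite E intr_int.
by split=> // j; apply: (@intr_inj R); rewrite dual_coord // E.
Qed.

Lemma dual_fvec i : dual_lattice L b (fvec e i).
Proof.
apply/dual_latticeP => j; rewrite dot_fvec.
have intD (x y : R) :
    x \is a Num.int -> y \is a Num.int -> x + y \is a Num.int.
  exact: rpredD.
have intB (x y : R) :
    x \is a Num.int -> y \is a Num.int -> x - y \is a Num.int.
  exact: rpredB.
have fI k : cyc_root j k \is a Num.int.
  by rewrite /cyc_root; case: ifP => _; [apply: intD | apply: intB];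
    exact: natr_int.
by case: ifP => _; [apply: intD | apply: intB]; exact: fI.
Qed.

(** The coordinates b(f_i, f_j) of f_i are 2 at i and 1 or -1 at its two
    neighbours on the cycle of length n. *)
Lemma fvec_coord i j : exists s s' t : int,
  fstar_coord e j (fvec e i) =
  2 * t + (2 * s + 1) * (j == (if i.+1 == n then 0 else i.+1)%N :> nat)%:Z
  + (2 * s' + 1) * (j == (if i == 0%N :> nat then n.-1 else i.-1)%N :> nat)%:Z.
Proof.
exists (if i.+1 == n then 0 else -1), (if i == 0%N :> nat then 0 else -1).
exists (i == j)%:Z.
apply: (@intr_inj R); rewrite dual_coord; last exact: dual_fvec.
rewrite dotC dot_fvec /cyc_root -[i == j]val_eqE /=.
have := ltn_ord i; have := ltn_ord j.
move: (nat_of_ord i) (nat_of_ord j) => {}i {}j lj li.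
by do !case: eqP => /= ?;
  first [lia | rewrite ?(rmorphD, rmorphM, rmorphN) /=; ring | idtac].
Qed.

Lemma fvec_coord_F2 i j : (fstar_coord e j (fvec e i))%:~R =
  (j == (if i.+1 == n then 0 else i.+1)%N :> nat)%:R
  + (j == (if i == 0%N :> nat then n.-1 else i.-1)%N :> nat)%:R :> 'F_2.
Proof.
have [s [s' [t ->]]] := fvec_coord i j.
move: (j == _ :> nat) (j == _ :> nat) => c d.
apply/eqP; rewrite -subr_eq0 -!(rmorph_nat (intr : int -> 'F_2)).
rewrite -rmorphD -rmorphB F2_int_eq0; apply/dvdzP; exists (t + s * d%:Z + s' * c%:Z).
by rewrite !natz; ring.
Qed.

Lemma fstar_coordD x y j : dual_lattice L b x -> dual_lattice L b y ->
  fstar_coord e j (x + y) = fstar_coord e j x + fstar_coord e j y.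
Proof.
move=> dx dy; apply: (@intr_inj R); rewrite rmorphD /= !dual_coord //.
  by rewrite linearDl.
exact: dualD.
Qed.

Lemma fstar_coord0 j : fstar_coord e j 0 = 0.
Proof. by rewrite /fstar_coord linear0 floor0. Qed.

(** * Construction A *)

Section ConstructionA.
Variable m : nat.

(* Integral lifts of the two components of rho. *)
Let oddc x : int := odd_sum (fun j => fstar_coord e j x).
Let evenc x : int := even_sum (fun j => fstar_coord e j x).
Let dual (x : {ffun 'I_m -> V}) := forall i : 'I_m, dual_lattice L b (x i).
Local Notation B := (sum_form b).
Local Notation rho := (@Defs.rho R V n m e).
Implicit Types x y : {ffun 'I_m -> V}.

Lemma rho_entry x i : rho x 0 i = ((oddc (x i))%:~R, (evenc (x i))%:~R).
Proof. by rewrite mxE /oddc /evenc !rmorph_sum. Qed.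

Lemma rhoD x y : dual x -> dual y -> rho (x + y) = rho x + rho y.
Proof.
move=> dx dy; apply/rowP => i; rewrite [RHS]mxE !rho_entry /oddc /evenc ffunE.
have E : (fun j => fstar_coord e j (x i + y i)) =
         (fun j => fstar_coord e j (x i) + fstar_coord e j (y i)).
  by apply: funext => j; exact: fstar_coordD.
by rewrite E /odd_sum /even_sum !big_split /= !rmorphD.
Qed.

(** Integral lifts of the two components, placed at the first odd and the first
    even position, reach every pair. *)
Lemma rho_surj (c : 'rV[F2F2]_m) : exists2 x, dual x & rho x = c.
Proof.
pose z (a : F2F2) (j : 'I_n) : int :=
  if j == 0%N :> nat then (a.1 : nat)%:Z else
  if j == 1%N :> nat then (a.2 : nat)%:Z else 0.
pose v a : V := \sum_j (z a j)%:~R *: fstar e j.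
exists [ffun i => v (c 0 i)].
  by move=> i; rewrite ffunE; exact: (dual_comb (z _)).1.
apply/rowP => i; rewrite rho_entry /oddc /evenc ffunE.
have -> : (fun j => fstar_coord e j (v (c 0 i))) = z (c 0 i).
  by apply: funext => j; exact: (dual_comb (z _)).2.
have l0 : (0 < n)%N by lia.
have l1 : (1 < n)%N by lia.
have -> : odd_sum (z (c 0 i)) = ((c 0 i).1 : nat)%:Z.
  rewrite /odd_sum (bigD1 (Ordinal l0)) //= big1 ?addr0 // => j.
  rewrite -val_eqE /z /= => /andP[oj /negbTE ->].
  by case: eqP => // E; move: oj; rewrite E.
have -> : even_sum (z (c 0 i)) = ((c 0 i).2 : nat)%:Z.
  rewrite /even_sum (bigD1 (Ordinal l1)) //= big1 ?addr0 // => j.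
  rewrite -val_eqE /z /= => /andP[oj /negbTE ->].
  by case: eqP => // E; move: oj; rewrite E.
case: (c 0 i) => a1 a2 /=; congr (_, _); exact: natr_Zp.
Qed.

Definition single (k : 'I_m) (v : V) : {ffun 'I_m -> V} :=
  [ffun i => if i == k then v else 0].

Lemma sum_form_single x k v : B x (single k v) = b (x k) v.
Proof.
rewrite /sum_form (bigD1 k) //= ffunE eqxx big1 ?addr0 // => i /negbTE nik.
by rewrite ffunE nik linear0r.
Qed.

Lemma dual0 : dual_lattice L b 0.
Proof.
by apply/dual_latticeP => j; rewrite linear0l; exact: (natr_int R 0).
Qed.

Lemma dual_single k v : dual_lattice L b v -> dual (single k v).
Proof. by move=> dv i; rewrite ffunE; case: ifP => _ //; exact: dual0. Qed.

(** The neighbours i - 1 and i + 1 on the cycle have the same parity because n is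
    even, so their contributions cancel modulo 2. *)
Lemma rho_fvec k i : rho (single k (fvec e i)) = 0.
Proof.
apply/rowP => l; rewrite !mxE ffunE; case: ifP => _; last first.
  by rewrite !big1 // => j _; rewrite fstar_coord0.
have [||| E1 E2] := parity_sum_pair _ _ _ (fvec_coord_F2 i); last by rewrite E1 E2.
all: have := ltn_ord i; do !case: eqP => //; lia.
Qed.

Let herm := (4 %| n)%N.

Lemma sum_form_mod x y (P : 'I_m -> int) (c d : int) :
  (forall i, exists t : int, 4 * b (x i) (y i) = (c * P i + d * t)%:~R) ->
  exists T : int, 4 * B x y = (c * (\sum_i P i) + d * T)%:~R.
Proof.
move=> /fin_all_exists[t Et]; exists (\sum_i t i).
rewrite /sum_form mulr_sumr (eq_bigr _ (fun i _ => Et i)) -rmorph_sum /=.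
by rewrite big_split /= !mulr_sumr.
Qed.

(** The congruence modulo 4 for b: n acts as 0 or as 2, which decides between
    the Hermitian and the Euclidean product. *)
Lemma sum_form_int x y : dual x -> dual y ->
  (B x y \is a Num.int <-> trdot herm (rho x) (rho y) = 0).
Proof.
move=> dx dy.
pose P i := if herm then oddc (x i) * evenc (y i) + evenc (x i) * oddc (y i)
            else oddc (x i) * oddc (y i) + evenc (x i) * evenc (y i).
have [|T ET] := @sum_form_mod x y P 2 4.
  move=> i; rewrite dot_dual //.
  have [t ->] := Qform_polar (fun j => fstar_coord e j (x i))
                             (fun j => fstar_coord e j (y i)).
  rewrite /P -/(oddc (x i)) -/(evenc (x i)) -/(oddc (y i)) -/(evenc (y i)).
  set X := oddc (x i); set Y := evenc (x i).
  set X' := oddc (y i); set Y' := evenc (y i).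
  case: ifP => h4.
    have -> : n%:Z = 4 * (n %/ 4)%N%:Z by move: h4; rewrite /herm; lia.
    exists ((n %/ 4)%N%:Z * (X + Y) * (X' + Y') - (X * Y' + Y * X') + t).
    by congr _%:~R; ring.
  have -> : n%:Z = 4 * (n %/ 4)%N%:Z + 2 by move: h4; rewrite /herm; lia.
  exists ((n %/ 4)%N%:Z * (X + Y) * (X' + Y') + t).
  by congr _%:~R; ring.
rewrite (quarter_int ET).
have -> : (4 %| 2 * \sum_i P i + 4 * T)%Z = (2 %| \sum_i P i)%Z by lia.
have -> : trdot herm (rho x) (rho y) = (\sum_i P i)%:~R.
  rewrite trdotE rmorph_sum; apply: eq_bigr => i _; rewrite !rho_entry /P /=.
  by case: ifP => _; rewrite rmorphD !rmorphM.
by rewrite -F2_int_eq0; split=> /eqP.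
Qed.

Lemma sum_form_even x (P : 'I_m -> int) (c : int) :
  (forall i, exists t : int, 4 * b (x i) (x i) = (c * P i + 8 * t)%:~R) ->
  (exists k : int, B x x = (2 * k)%:~R) <-> (8 %| c * \sum_i P i)%Z.
Proof.
move=> /sum_form_mod[T ET]; rewrite (quarter_even ET).
by have -> : (8 %| c * (\sum_i P i) + 8 * T)%Z = (8 %| c * (\sum_i P i))%Z
  by lia.
Qed.

Lemma norm_form x i : dual x -> exists t : int,
  4 * b (x i) (x i) = (n%:Z * (oddc (x i) + evenc (x i)) ^+ 2
   - 4 * (oddc (x i) * evenc (x i)) + 8 * t)%:~R.
Proof.
move=> dx; rewrite dot_dual //.
by have [t ->] := Qform_diag (fun j => fstar_coord e j (x i)); exists t.
Qed.

(** Modulo 8, with n = 4p + 2, four times the norm is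
    2 (2p + 1) (A^2 + B^2), and a square is 0 or 1 modulo 4. *)
Lemma even_norm_wtL x : ~~ (4 %| n)%N -> dual x ->
  (exists k : int, B x x = (2 * k)%:~R) <-> (4 %| wtL (rho x))%N.
Proof.
move=> h4 dx; pose p := (n %/ 4)%N%:Z.
have En : n%:Z = 4 * p + 2 by rewrite /p; lia.
have H i : exists t : int, 4 * b (x i) (x i) =
    ((2 * (2 * p + 1)) * ((~~ (2 %| oddc (x i))%Z)%:Z
                          + (~~ (2 %| evenc (x i))%Z)%:Z) + 8 * t)%:~R.
  have [t ->] := norm_form i dx; rewrite En.
  move: (oddc (x i)) (evenc (x i)) => X Y.
  have [s Es] := sqr_mod4 X; have [s' Es'] := sqr_mod4 Y.
  exists (p * X * Y + (2 * p + 1) * (s + s') + t); congr _%:~R.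
  transitivity (2 * (2 * p + 1) * (X ^+ 2 + Y ^+ 2) + 8 * (p * X * Y + t)).
    by ring.
  by rewrite Es Es'; ring.
rewrite (sum_form_even H).
have -> : \sum_(i < m) ((~~ (2 %| oddc (x i))%Z)%:Z
                         + (~~ (2 %| evenc (x i))%Z)%:Z) =
  (wtL (rho x))%:Z.
  rewrite wtLE -[RHS]natz natr_sum; apply: eq_bigr => i _.
  by rewrite rho_entry /= !F2_int_eq0 natrD !natz.
have -> : (8 %| 2 * (2 * p + 1) * wtL (rho x))%Z =
          (4 %| (2 * p + 1) * wtL (rho x))%Z.
  by rewrite -mulrA; move: ((2 * p + 1) * _); lia.
split=> [/dvdzP[c Ec]|W4]; last by apply: dvdz_mull.
(* (2p + 1)^2 - 4 (p^2 + p) = 1, so 2p + 1 is its own inverse modulo 4. *)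
apply/(@dvdzP 4 (wtL (rho x))).
exists ((2 * p + 1) * c - (p ^+ 2 + p) * wtL (rho x)).
by rewrite mulrBl -mulrA -Ec; ring.
Qed.

(** Modulo 8, with n = 8p + 4, four times the norm is 4 (A^2 + A B + B^2), and
    X^2 + X Y + Y^2 is anisotropic over F_2. *)
Lemma even_norm_wtH x : (4 %| n)%N -> ~~ (8 %| n)%N -> dual x ->
  (exists k : int, B x x = (2 * k)%:~R) <-> (2 %| wtH (rho x))%N.
Proof.
move=> h4 h8 dx; pose p := (n %/ 8)%N%:Z.
have En : n%:Z = 8 * p + 4 by rewrite /p; lia.
have H i : exists t : int, 4 * b (x i) (x i) =
    (4 * (~~ (2 %| oddc (x i))%Z || ~~ (2 %| evenc (x i))%Z)%:Z + 8 * t)%:~R.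
  have [t ->] := norm_form i dx; rewrite En.
  move: (oddc (x i)) (evenc (x i)) => X Y.
  have [u Eu] : exists u, X ^+ 2 + X * Y + Y ^+ 2 =
      (~~ (2 %| X)%Z || ~~ (2 %| Y)%Z)%:Z + 2 * u.
    have par (k : int) : exists c, k = 2 * c + (~~ (2 %| k)%Z)%:Z.
      by exists (k %/ 2)%Z; lia.
    have [c] := par X; have [d] := par Y.
    case: (2 %| X)%Z; case: (2 %| Y)%Z => /= -> ->.
    - by exists (2 * c ^+ 2 + 2 * c * d + 2 * d ^+ 2); ring.
    - by exists (2 * c ^+ 2 + 2 * c * d + c + 2 * d ^+ 2 + 2 * d); ring.
    - by exists (2 * c ^+ 2 + 2 * c + 2 * c * d + d + 2 * d ^+ 2); ring.
    - by exists (2 * c ^+ 2 + 3 * c + 2 * c * d + 3 * d + 2 * d ^+ 2 + 1); ring.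
  exists (p * (X + Y) ^+ 2 + u + t); congr _%:~R.
  transitivity (4 * (X ^+ 2 + X * Y + Y ^+ 2) + 8 * (p * (X + Y) ^+ 2 + t)).
    by ring.
  by rewrite Eu; ring.
rewrite (sum_form_even H).
have -> : \sum_(i < m) (~~ (2 %| oddc (x i))%Z || ~~ (2 %| evenc (x i))%Z)%:Z
  = (wtH (rho x))%:Z.
  rewrite wtHE -[RHS]natz natr_sum; apply: eq_bigr => i _.
  by rewrite [RHS]natz rho_entry /= !F2_int_eq0.
by split; lia.
Qed.

(** Modulo 8, four times the norm is -4 A B, and the sum of the A B modulo 2 is a
    component of the Hermitian square of rho x. *)
Lemma even_norm_dotp x : (8 %| n)%N -> dual x ->
  dotp (rho x) (conj_vec (rho x)) = 0 -> exists k : int, B x x = (2 * k)%:~R.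
Proof.
move=> h8 dx x0; pose p := (n %/ 8)%N%:Z.
have En : n%:Z = 8 * p by rewrite /p; lia.
have H i : exists t : int, 4 * b (x i) (x i) =
    ((-4) * (oddc (x i) * evenc (x i)) + 8 * t)%:~R.
  have [t ->] := norm_form i dx; rewrite En.
  exists (p * (oddc (x i) + evenc (x i)) ^+ 2 + t); congr _%:~R; ring.
apply/(sum_form_even H).
suff: (2 %| \sum_i oddc (x i) * evenc (x i))%Z by move: (\sum_i _) => S; lia.
have := congr1 fst x0; rewrite dotp1 => S0.
rewrite -F2_int_eq0 rmorph_sum -[X in _ == X]S0; apply/eqP.
apply: eq_bigr => i _.
by rewrite rmorphM rho_entry [conj_vec _ _ _]mxE rho_entry.
Qed.

Section Code.
Variable C : {set 'rV[F2F2]_m}.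
Hypothesis hC : is_code C.
Local Notation G := (Gamma L b e C).

Lemma Gamma_fvec k i : G (single k (fvec e i)).
Proof.
split; first by apply: dual_single; exact: dual_fvec.
by rewrite rho_fvec; case: hC.
Qed.

(** Gamma_C contains the f_i in each component, so it has full rank. *)
Lemma Rspan_Gamma x : Rspan G x.
Proof.
pose S := [seq single k (fvec e i) | k <- enum 'I_m, i <- enum 'I_n].
exists S; first by move=> u /allpairsP[[k i] [_ _ ->]]; exact: Gamma_fvec.
have mem k i : single k (fvec e i) \in <<S>>%VS.
  by apply/memv_span/allpairs_f; rewrite mem_enum.
have meme k i : single k (tnth e i) \in <<S>>%VS.
  have -> : single k (tnth e i) = single k (fvec e i) -
     if i.+1 == n then \sum_(l < n | (l.+1 <= n - 2)%N) single k (fvec e l)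
     else 0.
    apply/ffunP => l; rewrite !ffunE basis_fvec.
    case: (i.+1 == n); rewrite ?sum_ffunE ?ffunE; case: eqP => lk //=;
      rewrite ?subr0 //.
      by congr (_ - _); apply: eq_bigr => j _; rewrite ffunE lk eqxx.
    by rewrite big1 ?subr0 // => j _; rewrite ffunE; case: eqP.
  rewrite memvB //; case: ifP => _; last exact: mem0v.
  by apply: memv_suml => j _; exact: mem.
have -> : x = \sum_k \sum_i coord e i (x k) *: single k (tnth e i).
  apply/ffunP => l; rewrite sum_ffunE (bigD1 l) //= sum_ffunE.
  rewrite [X in _ + X]big1 ?addr0.
    rewrite {1}(basis_expansion (x l)); apply: eq_bigr => i _.
    by rewrite !ffunE eqxx.
  move=> k nkl; rewrite sum_ffunE big1 // => i _.
  by rewrite !ffunE eq_sym (negbTE nkl) scaler0.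
by apply: memv_suml => k _; apply: memv_suml => i _; exact: memvZ.
Qed.

(** Pairing with the f_j placed in a single component forces the components of a
    dual vector into the dual lattice; from there on [sum_form_int] and
    [trdot_perp] apply. *)
Lemma dual_Gamma : dual_lattice G B = Gamma L b e (perp herm C).
Proof.
apply/seteqP; split=> x.
  move=> [_ xG]; have dx : dual x.
    move=> k; apply/dual_latticeP => j.
    by rewrite -sum_form_single; apply: xG; exact: Gamma_fvec.
  split=> //; apply/trdot_perp => // c cC.
  have [y dy Ey] := rho_surj c.
  by rewrite -Ey; apply/sum_form_int => //; apply: xG; split=> //; rewrite Ey.
move=> [dx /(trdot_perp _ _ hC) xC]; split; first exact: Rspan_Gamma.
by move=> y [dy yC]; apply/sum_form_int => //; exact: xC.
Qed.

Lemma Gamma_subset (D : {set 'rV[F2F2]_m}) :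
  (G `<=` Gamma L b e D)%classic <-> C \subset D.
Proof.
split=> [GD|/fintype.subsetP CD x [dx xC]]; last by split=> //; exact: CD.
apply/fintype.subsetP => c cC; have [x dx Ex] := rho_surj c.
by rewrite -Ex; apply: (GD x _).2; split=> //; rewrite Ex.
Qed.

Lemma integral_Gamma : integral_lattice G B <-> C \subset perp herm C.
Proof.
rewrite -Gamma_subset -dual_Gamma; split=> [GB x Gx|GD x y Gx Gy].
  by split; [exact: Rspan_Gamma | move=> y; exact: GB].
exact: (GD x Gx).2.
Qed.

Lemma unimodular_Gamma : unimodular_lattice G B <-> C = perp herm C.
Proof.
rewrite /unimodular_lattice dual_Gamma; split=> [E|<- //].
apply/eqP; rewrite finset.eqEsubset; apply/andP; split.
  by apply/Gamma_subset; rewrite E.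
apply/fintype.subsetP => c cD; have [x dx Ex] := rho_surj c.
have [_] : G x by rewrite -E; split=> //; rewrite Ex.
by rewrite Ex.
Qed.

(** 2 B(x, y) = B(x + y, x + y) - B(x, x) - B(y, y), so even norms make the form
    integral. *)
Lemma even_norms :
  (forall x, G x -> exists k : int, B x x = (2 * k)%:~R) -> even_lattice G B.
Proof.
move=> Gev; split=> // x y Gx Gy.
have [k Ek] := Gev x Gx; have [l El] := Gev y Gy.
have [r Er] : exists k : int, B (x + y) (x + y) = (2 * k)%:~R.
  case: Gx Gy => [dx xC] [dy yC]; apply: Gev; split.
    by move=> i; rewrite ffunE; exact: dualD.
  rewrite rhoD //; case: hC => _ /(_ 1 _ _ xC yC).
  by rewrite scale1r.
apply/intrP; exists (r - k - l); apply: (@mulfI _ 2); first by rewrite pnatr_eq0.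
rewrite !rmorphM /= in Ek El Er.
rewrite !rmorphB /= !mulrBr -Er -Ek -El /sum_form -!sumrB mulr_sumr.
apply: eq_bigr => i _; rewrite ffunE linearDl !linearDr /= (dotC (y i) (x i)).
by ring.
Qed.

Lemma even_Gamma (P : pred 'rV[F2F2]_m) :
  (forall x, dual x -> (exists k : int, B x x = (2 * k)%:~R) <-> P (rho x)) ->
  even_lattice G B <-> forall c, c \in C -> P c.
Proof.
move=> HP; split=> [[_ Gev] c cC|PC].
  have [x dx Ex] := rho_surj c.
  by rewrite -Ex; apply/HP => //; apply: Gev; split=> //; rewrite Ex.
by apply: even_norms => x [dx xC]; apply/HP => //; exact: PC.
Qed.

(** Every codeword orthogonal to the conjugate code is orthogonal to its own
    conjugate, so evenness comes for free with integrality. *)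
Lemma even_Gamma_8 : (8 %| n)%N -> even_lattice G B <-> C \subset perp herm C.
Proof.
move=> h8; split=> [[/integral_Gamma]//|CD].
apply: even_norms => x [dx xC]; apply: even_norm_dotp => //.
have /mem_perp/(_ _ xC) := fintype.subsetP CD _ xC.
by rewrite /twist (_ : herm = true) // /herm; lia.
Qed.

End Code.
End ConstructionA.
End DnLattice.

Theorem theorem3p24 (R : realType) (V : vectType R) (n m : nat)
  (hn4 : (4 <= n)%N) (hn : (2 %| n)%N) (hm : (0 < m)%N)
  (L : set V) (b : {dot V for idfun}) (e : n.-tuple V)
  (hL : is_Dn_basis L b e)
  (C : {set 'rV[F2F2]_m}) (hC : is_code C) :
  let G := Gamma L b e C in
  let B := sum_form b in
  [/\ (* (a) *)
      (2 %| n)%N -> ~~ (4 %| n)%N ->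
      [/\ integral_lattice G B <-> C \subset dual_code C,
          unimodular_lattice G B <-> euclidean_self_dual C,
          even_lattice G B <-> (forall x, x \in C -> (4 %| wtL x)%N) &
          even_lattice G B /\ unimodular_lattice G B <-> type_II C],
      (* (b) *)
      (4 %| n)%N -> ~~ (8 %| n)%N ->
      [/\ integral_lattice G B <-> C \subset herm_dual_code C,
          unimodular_lattice G B <-> hermitian_self_dual C,
          even_lattice G B <-> (forall x, x \in C -> (2 %| wtH x)%N) &
          even_lattice G B /\ unimodular_lattice G B <-> type_IV C] &
      (* (c) *)
      (8 %| n)%N ->
      [/\ integral_lattice G B <-> C \subset herm_dual_code C,
          unimodular_lattice G B <-> hermitian_self_dual C,
          even_lattice G B <-> C \subset herm_dual_code C &
          even_lattice G B /\ unimodular_lattice G B <-> hermitian_self_dual C]].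
Proof.
move=> G B; have nodd : ~~ odd n by rewrite -dvdn2.
have HI := integral_Gamma hn4 nodd hL hC.
have HU := unimodular_Gamma hn4 nodd hL hC.
split=> [_ h4|h4 h8|h8].
- rewrite (negbTE h4) /perp in HI HU.
  have HE : even_lattice G B <-> (forall x, x \in C -> (4 %| wtL x)%N).
    by apply: even_Gamma => // x; exact: even_norm_wtL.
  by split=> //; rewrite HE HU and_comm.
- rewrite h4 /perp in HI HU.
  have HE : even_lattice G B <-> (forall x, x \in C -> (2 %| wtH x)%N).
    by apply: even_Gamma => // x; exact: even_norm_wtH.
  by split=> //; rewrite HE HU and_comm.
have h4 : (4 %| n)%N by exact: dvdn_trans h8.
have HE := even_Gamma_8 hn4 nodd hL hC h8.
rewrite h4 /perp in HI HU HE.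
by split=> //; rewrite HE HU; split=> [[]|E] //; split=> //; rewrite {1}E.
Qed.
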